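(* Let $A\subseteq\omega$ be an infinite c.e. set and let $\theta$ be a quasi-Gödel numbering of $\mathcal S^{(1)}_A$. Then: (1) $\theta$ is complete with the nowhere defined function as distinguished element; that is, for every $p\in\mathcal P^{(1)}$ there exists $g\in\mathcal R^{(1)}$ such that for all $i\in\omega$: $\theta_{g(i)}=\theta_{p(i)}$ if $i\in\mathrm{dom}(p)$, and $\theta_{g(i)}$ is the nowhere defined function otherwise. (2) $\theta$ is cylindrical; that is, $\theta$ is computably isomorphic to the numbering $\theta^c$ defined by $\theta^c_{\langle i,j\rangle}=\theta_j$ (there is a computable bijection $h:\omega\to\omega$ with $\theta^c=\theta\circ h$).
   Context: $\omega$ is the set of natural numbers; $\mathcal P^{(n)}$ and $\mathcal R^{(n)}$ are the sets of $n$-ary partial, respectively total, computable functions on $\omega$. $\langle\cdot,\cdot\rangle:\omega^2\to\omega$ is a computable bijection with $\langle x,y\rangle\ge x,y$. $\mathrm{Anf}^{(1)}_A$ is the set of partial functions from $\omega$ to $\omega$ whose domain is either empty or equal to $\{0,\dots,a-1\}$ for some $a\in A$, and $\mathcal S^{(1)}_A=\mathcal R^{(1)}\cup\mathrm{Anf}^{(1)}_A$. The extended graph of a unary partial function $q$ is $\{\langle y,0\rangle:y\in\omega\}\cup\{\langle x,q(x)+1\rangle:x\in\mathrm{dom}(q)\}$; that of a binary partial function $q$ is $\{\langle\langle y,y'\rangle,0\rangle:y,y'\in\omega\}\cup\{\langle\langle x,x'\rangle,q(x,x')+1\rangle:(x,x')\in\mathrm{dom}(q)\}$. A numbering of a set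 $X$ is a surjection $\omega\to X$. A numbering $\theta$ of $\mathcal S^{(1)}_A$ is a quasi-Gödel numbering if: (QGN I) the extended graph of $(i,x)\mapsto\theta_i(x)$ is the range of a function in $\mathcal R^{(1)}$; and (QGN II) for every $k\in\mathcal R^{(2)}$ there is $v\in\mathcal R^{(1)}$ such that for all $i\in\omega$, $r\in\mathcal S^{(1)}_A$: if $\{k(i,t):t\in\omega\}$ is the extended graph of $r$, then $r=\theta_{v(i)}$. *)

(* Defs.v *)
From mathcomp Require Import all_boot.
From mathcomp Require Import boolp classical_sets cardinality.

Set Implicit Arguments.
Unset Strict Implicit.
Unset Printing Implicit Defensive.

Local Open Scope classical_set_scope.

(* n-ary mu-recursive schemes. [Rec f g] is primitive recursion on the first
   argument, with h(0, xs) = f(xs) and h(k+1, xs) = g(k, h(k, xs), xs);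
   [Mu f] is xs |-> mu y, f(y, xs) = 0. *)
Inductive recfn : nat -> Type :=
| Zero n : recfn n
| Succ : recfn 1
| Proj n (i : 'I_n) : recfn n
| Comp m n (f : recfn m) (g : 'I_m -> recfn n) : recfn n
| Rec n (f : recfn n) (g : recfn n.+2) : recfn n.+1
| Mu n (f : recfn n.+1) : recfn n.

Fixpoint rec_graph (F : nat -> Prop) (G : nat -> nat -> nat -> Prop)
    (k y : nat) : Prop :=
  if k is k'.+1 then exists2 z, rec_graph F G k' z & G k' z y else F y.

(* [eval c xs y]: the scheme c is defined at xs, with value y. In [Mu f], all
   values f(z, xs) with z < y must be defined and nonzero. *)
Fixpoint eval n (c : recfn n) : n.-tuple nat -> nat -> Prop :=
  match c in recfn n return n.-tuple nat -> nat -> Prop with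
  | Zero _ => fun _ y => y = 0
  | Succ => fun xs y => y = (thead xs).+1
  | Proj _ i => fun xs y => y = tnth xs i
  | Comp m _ f g => fun xs y =>
      exists2 ys : m.-tuple nat,
        forall i, eval (g i) xs (tnth ys i) & eval f ys y
  | Rec _ f g => fun xs y =>
      rec_graph (eval f [tuple of behead xs])
        (fun k z => eval g [tuple of k :: z :: behead xs]) (thead xs) y
  | Mu _ f => fun xs y =>
      eval f [tuple of y :: xs] 0 /\
      forall z, z < y -> exists v, eval f [tuple of z :: xs] v.+1
  end.

Definition pfun1 := nat -> option nat.
Definition pfun2 := nat -> nat -> option nat.

Definition dom (q : pfun1) : set nat := [set x | isSome (q x)].

Definition nowhere : pfun1 := fun=> None.

Definition partial_computable1 (p : pfun1) : Prop :=
  exists c : recfn 1, forall x y, p x = Some y <-> eval c [tuple x] y.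

Definition partial_computable2 (p : pfun2) : Prop :=
  exists c : recfn 2, forall x x' y,
    p x x' = Some y <-> eval c [tuple x; x'] y.

Definition computable1 (f : nat -> nat) : Prop :=
  partial_computable1 (fun x => Some (f x)).

Definition computable2 (f : nat -> nat -> nat) : Prop :=
  partial_computable2 (fun x x' => Some (f x x')).

Definition ce (A : set nat) : Prop :=
  exists2 p, partial_computable1 p & A = dom p.

Definition computable_pairing (pr : nat -> nat -> nat) : Prop :=
  [/\ computable2 pr,
      bijective (fun xy : nat * nat => pr xy.1 xy.2),
      forall x y, x <= pr x y
    & forall x y, y <= pr x y].

Definition Anf (A : set nat) : set pfun1 :=
  [set q | dom q = set0 \/ exists2 a, A a & dom q = [set x | x < a]].

Definition total_computable : set pfun1 :=
  [set q | exists2 f, computable1 f & q = (fun x => Some (f x))].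

Definition S1 (A : set nat) : set pfun1 := total_computable `|` Anf A.

Definition ext_graph1 (pr : nat -> nat -> nat) (q : pfun1) : set nat :=
  [set pr y 0 | y in setT] `|`
  [set z | exists x v, q x = Some v /\ z = pr x v.+1].

Definition ext_graph2 (pr : nat -> nat -> nat) (q : pfun2) : set nat :=
  [set z | exists y y', z = pr (pr y y') 0] `|`
  [set z | exists x x' v, q x x' = Some v /\ z = pr (pr x x') v.+1].

Definition numbering (T : Type) (X : set T) (theta : nat -> T) : Prop :=
  range theta = X.

Definition QGN1 (pr : nat -> nat -> nat) (theta : nat -> pfun1) : Prop :=
  exists2 f, computable1 f & range f = ext_graph2 pr theta.

Definition QGN2 (pr : nat -> nat -> nat) (A : set nat)
    (theta : nat -> pfun1) : Prop :=
  forall k, computable2 k ->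
    exists2 v, computable1 v &
      forall (i : nat) (r : pfun1), S1 A r ->
        range (k i) = ext_graph1 pr r -> r = theta (v i).

Definition quasi_Goedel_numbering (pr : nat -> nat -> nat) (A : set nat)
    (theta : nat -> pfun1) : Prop :=
  [/\ numbering (S1 A) theta, QGN1 pr theta & QGN2 pr A theta].

Definition complete_numbering (T : Type) (theta : nat -> T) (e : T) : Prop :=
  forall p, partial_computable1 p ->
    exists2 g, computable1 g &
      forall i, theta (g i) = if p i is Some j then theta j else e.

Definition computably_isomorphic (T : Type) (theta theta' : nat -> T) : Prop :=
  exists h, [/\ computable1 h, bijective h & theta = theta' \o h].

(* Since pr is a bijection, the first condition determines thetac uniquely. *)
Definition cylindrical (pr : nat -> nat -> nat) (T : Type)
    (theta : nat -> T) : Prop :=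
  exists2 thetac : nat -> T,
    forall i j, thetac (pr i j) = theta j & computably_isomorphic thetac theta.

(* Main.v *)
(* An enumeration of the extended graph of [theta] yields, for a partial
   computable [p], an enumeration in [t], uniform in [i], of the extended graph of
   [theta_(p i)]: as long as [p i] is not known to converge, only the pairs
   [<y, 0>] are listed, and these make up the extended graph of [nowhere]. This
   gives completeness. Applied to the diagonal [x |-> theta_x(x)], completeness
   gives the recursion theorem, and the latter gives a computable way of finding
   arbitrarily large indices of [theta_j] from [j]. *)
Require Import Defs.
From mathcomp Require Import all_boot.
From mathcomp Require Import boolp classical_sets cardinality.

Set Implicit Arguments.
Unset Strict Implicit.
Unset Printing Implicit Defensive.

(** * Closure properties of total computable functions *)

Definition cfun n (F : seq nat -> nat) : Prop :=
  exists c : recfn n, forall (xs : n.-tuple nat) y, eval c xs y <-> y = F xs.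

Notation cpred n P := (cfun n (fun xs => nat_of_bool (P xs))).

Lemma cfun_ext n F G :
  (forall xs, size xs = n -> F xs = G xs) -> cfun n F -> cfun n G.
Proof.
by move=> FG [c cP]; exists c => xs y; rewrite cP FG // size_tuple.
Qed.

Lemma cfun_nth n i : cfun n (nth 0 ^~ i).
Proof.
case: (ltnP i n) => [lt_in | le_ni].
  exists (Proj (Ordinal lt_in)) => xs y /=.
  by rewrite (tnth_nth 0).
by exists (Zero n) => xs y /=; rewrite nth_default // size_tuple.
Qed.

Lemma cfun_comp m n F (Gs : seq (seq nat -> nat)) :
    size Gs = m -> cfun m F ->
    (forall i, i < m -> cfun n (nth (fun=> 0) Gs i)) ->
  cfun n (fun xs => F [seq G xs | G <- Gs]).
Proof.
move=> szG [f fP] GsP.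
have /choice[g gP] (i : 'I_m) := GsP i (ltn_ord i).
exists (Comp f g) => xs y /=.
have szt : size [seq (G : seq nat -> nat) xs | G <- Gs] == m by rewrite size_map szG.
split=> [[ys ysP /fP ->] | ->].
  congr F; apply: (@eq_from_nth _ 0); rewrite size_tuple ?(eqP szt) // => i im.
  have /gP := ysP (Ordinal im); rewrite (tnth_nth 0) /= => ->.
  by rewrite (nth_map (fun=> 0)) // szG.
exists (Tuple szt); last by apply/fP.
by move=> i; apply/gP; rewrite (tnth_nth 0) /= (nth_map (fun=> 0)) // szG.
Qed.

Lemma cfun_S n F : cfun n F -> cfun n (fun xs => (F xs).+1).
Proof.
move=> FP; have S1P : cfun 1 (fun xs => (nth 0 xs 0).+1).
  by exists Succ => xs y /=; case/tupleP: xs.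
by apply: (cfun_comp (Gs := [:: F]) _ S1P) => // -[].
Qed.

Lemma cfun_const n k : cfun n (fun=> k).
Proof. by elim: k => [|k IH]; [exists (Zero n) | exact: cfun_S]. Qed.

(** Composition in which the [m] arguments after the first [k] are passed on by projections. It
    serves to reshape the list [k :: z :: xs] that arises in a recursion step. *)
Lemma cfun_cat k m n F (Gs : seq (seq nat -> nat)) :
    n = k + m -> cfun (size Gs + m) F ->
    (forall i, i < size Gs -> cfun n (nth (fun=> 0) Gs i)) ->
  cfun n (fun xs => F ([seq G xs | G <- Gs] ++ drop k xs)).
Proof.
move=> -> FP GsP; pose Hs := Gs ++ [seq nth 0 ^~ i | i <- iota k m].
apply: (@cfun_ext _ (fun xs => F [seq H xs | H <- Hs])).
  move=> xs szx; rewrite map_cat -map_comp.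
  rewrite (_ : map (_ \o _) _ = map (nth 0 xs) (iota k m)) //.
  by rewrite map_nth_iota ?take_oversize ?size_drop ?szx ?addKn.
apply: (cfun_comp (Gs := Hs) _ FP) => [|i im].
  by rewrite size_cat size_map size_iota.
rewrite nth_cat; case: ltnP => [/GsP // | le_Gsi].
by rewrite (nth_map 0) ?size_iota ?ltn_subLR //; exact: cfun_nth.
Qed.

Lemma cfun_drop k m n F : n = k + m -> cfun m F -> cfun n (fun xs => F (drop k xs)).
Proof. by move=> nE FP; apply: (cfun_cat (Gs := [::])) nE FP _. Qed.

Definition natrec (a : nat) (f : nat -> nat -> nat) (k : nat) : nat :=
  nat_rect (fun=> nat) a f k.

Lemma rec_graph_natrec F G a f k y :
    (forall z, F z <-> z = a) -> (forall k z v, G k z v <-> v = f k z) ->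
  rec_graph F G k y <-> y = natrec a f k.
Proof.
move=> FP GP; elim: k y => [|k IH] y /=; first exact: FP.
split=> [[z /IH -> /GP ->] // | ->].
by exists (natrec a f k); [exact/IH | exact/GP].
Qed.

(** A more flexible form of [Rec]: the number of steps is computed by [K], and the whole list [xs]
    serves as parameters. *)
Lemma cfun_natrec n F G K :
    cfun n F -> cfun n.+2 G -> cfun n K ->
  cfun n (fun xs => natrec (F xs) (fun k z => G (k :: z :: xs)) (K xs)).
Proof.
move=> [f fP] [g gP] KP.
have RP : cfun n.+1 (fun xs => natrec (F (behead xs))
    (fun k z => G (k :: z :: behead xs)) (head 0 xs)).
  exists (Rec f g) => xs y /=.
  have -> : head 0 xs = thead xs by case/tupleP: xs.
  by apply: rec_graph_natrec => [z|k z v]; [exact: fP | exact: gP].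
apply: (@cfun_ext _ (fun xs => natrec (F (drop 0 xs))
    (fun k z => G (k :: z :: drop 0 xs)) (K xs))).
  by move=> xs _; rewrite drop0.
by apply: (cfun_cat (k := 0) (Gs := [:: K]) _ RP) => // -[].
Qed.

Lemma cfun_computable1 n f F :
  computable1 f -> cfun n F -> cfun n (fun xs => f (F xs)).
Proof.
move=> [c cP] FP; have f1 : cfun 1 (fun xs => f (nth 0 xs 0)).
  exists c => xs y; case/tupleP: xs => x xs; rewrite (tuple0 xs).
  by rewrite -[[tuple of _]]/[tuple x] -cP /=; split=> [[->]|->].
by apply: (cfun_comp (Gs := [:: F]) _ f1) => // -[].
Qed.

Lemma cfun_computable2 n f F G :
  computable2 f -> cfun n F -> cfun n G -> cfun n (fun xs => f (F xs) (G xs)).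
Proof.
move=> [c cP] FP GP; have f2 : cfun 2 (fun xs => f (nth 0 xs 0) (nth 0 xs 1)).
  exists c => xs y; case/tupleP: xs => x xs; case/tupleP: xs => x' xs.
  rewrite (tuple0 xs) (_ : [tuple of _] = [tuple x; x']); last exact/val_inj.
  by rewrite -cP /=; split=> [[->]|->].
by apply: (cfun_comp (Gs := [:: F; G]) _ f2) => // -[|[]].
Qed.

Lemma computable1P f : cfun 1 (fun xs => f (nth 0 xs 0)) -> computable1 f.
Proof.
move=> [c cP]; exists c => x y; rewrite cP /=.
by split=> [[->]|->].
Qed.

Lemma computable2P f :
  cfun 2 (fun xs => f (nth 0 xs 0) (nth 0 xs 1)) -> computable2 f.
Proof.
move=> [c cP]; exists c => x x' y; rewrite cP /=.
by split=> [[->]|->].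
Qed.

Lemma cfun_if n P F G : cpred n P -> cfun n F -> cfun n G ->
  cfun n (fun xs => if P xs then F xs else G xs).
Proof.
move=> PP FP GP.
(* The truth value is the number of recursion steps: none leaves [G xs], one replaces it by
   [F xs]. *)
apply: (@cfun_ext _ (fun xs => natrec (G xs)
  (fun k z => F (drop 2 (k :: z :: xs))) (P xs))).
  by move=> xs _; rewrite /= drop0; case: (P xs).
apply: (cfun_natrec (G := fun l => F (drop 2 l))) => //.
exact: cfun_drop FP.
Qed.

Lemma cfun_pred n F : cfun n F -> cfun n (fun xs => (F xs).-1).
Proof.
move=> FP; apply: (@cfun_ext _ (fun xs => natrec 0
  (fun k z => nth 0 (k :: z :: xs) 0) (F xs))).
  by move=> xs _; case: (F xs).
apply: (cfun_natrec (G := nth 0 ^~ 0)) => //; first exact: cfun_const.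
exact: cfun_nth.
Qed.

Lemma cfun_sub n F G :
  cfun n F -> cfun n G -> cfun n (fun xs => F xs - G xs).
Proof.
move=> FP GP; apply: (@cfun_ext _ (fun xs => natrec (F xs)
  (fun k z => (nth 0 (k :: z :: xs) 1).-1) (G xs))).
  by move=> xs _; elim: (G xs) => [|k IH]; rewrite ?subn0 // subnS -IH.
apply: (cfun_natrec (G := fun l => (nth 0 l 1).-1)) => //.
exact/cfun_pred/cfun_nth.
Qed.

Lemma cpred_neg n P : cpred n P -> cpred n (fun xs => ~~ P xs).
Proof.
move=> PP; apply: (@cfun_ext _ (fun xs => 1 - P xs)).
  by move=> xs _; case: (P xs).
by apply: cfun_sub => //; exact: cfun_const.
Qed.

Lemma cpred_and n P Q :
  cpred n P -> cpred n Q -> cpred n (fun xs => P xs && Q xs).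
Proof.
move=> PP QP; apply: (@cfun_ext _ (fun xs => if P xs then Q xs : nat else 0)).
  by move=> xs _; case: (P xs).
by apply: cfun_if => //; exact: cfun_const.
Qed.

Lemma cpred_leq n F G :
  cfun n F -> cfun n G -> cpred n (fun xs => F xs <= G xs).
Proof.
move=> FP GP; apply: (@cfun_ext _ (fun xs => 1 - (F xs - G xs))).
  by move=> xs _; rewrite /leq; case: (F xs - G xs).
by apply: cfun_sub; [exact: cfun_const | exact: cfun_sub].
Qed.

Lemma cpred_eq n F G :
  cfun n F -> cfun n G -> cpred n (fun xs => F xs == G xs).
Proof.
move=> FP GP.
apply: (@cfun_ext _ (fun xs => (F xs <= G xs) && (G xs <= F xs))).
  by move=> xs _; rewrite -eqn_leq.
by apply: cpred_and; exact: cpred_leq.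
Qed.

(* The largest [c < b] satisfying [P], with junk value [0] if there is none. *)
Definition bsearch (P : pred nat) (b : nat) : nat :=
  natrec 0 (fun c z => if P c then c else z) b.

Lemma bsearchP (P : pred nat) b c : c < b -> P c -> P (bsearch P b).
Proof.
elim: b => // b IH; rewrite ltnS leq_eqVlt /= => /predU1P[-> Pb | lt_cb Pc].
  by rewrite /bsearch /= Pb.
by rewrite /bsearch /= -/(bsearch P b); case: ifP => // _; apply: IH.
Qed.

Lemma cfun_bsearch n (P : seq nat -> bool) B : cpred n.+1 P -> cfun n B ->
  cfun n (fun xs => bsearch (fun c => P (c :: xs)) (B xs)).
Proof.
move=> PP BP; pose G (l : seq nat) :=
  if P (nth 0 l 0 :: drop 2 l) then nth 0 l 0 else nth 0 l 1.
apply: (@cfun_ext _ (fun xs => natrec 0 (fun k z => G (k :: z :: xs)) (B xs))).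
  by move=> xs _; rewrite /G /= drop0.
apply: cfun_natrec BP; first exact: cfun_const.
apply: cfun_if; try exact: cfun_nth.
apply: (cfun_cat (k := 2) (Gs := [:: nth 0 ^~ 0]) _ PP) => // -[] // _.
exact: cfun_nth.
Qed.

(** * Evaluation of schemes with cut-off searches *)

(* The search of [Mu] cut off after [b] steps, on values encoded as in [stage]
   below: [0] means still searching, [1] stuck on an undefined value, and [y.+2]
   that the zero [y] has been found. *)
Definition mu_loop (F : nat -> nat) (b : nat) : nat :=
  natrec 0 (fun y z => if 0 < z then z else
    if F y == 0 then 1 else if F y == 1 then y.+2 else 0) b.

(** [F z] encodes a value as its successor and undefinedness as [0], so [1 < F z] means defined and
    nonzero: exactly the case in which the search moves on. *)
Lemma mu_loop0 F b : mu_loop F b = 0 <-> forall z, z < b -> 1 < F z.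
Proof.
elim: b => [|b IH] //=; rewrite -/(mu_loop F b).
split.
  case: ltnP => [|]; first by move=> + e; rewrite e.
  rewrite leqn0 => /eqP /IH Fb + z; rewrite ltnS leq_eqVlt.
  by case Eb: (F b) => [|[|v]] // _ /predU1P[->|/Fb //]; rewrite Eb.
move=> Fb; have /IH -> : forall z, z < b -> 1 < F z by move=> z /ltnW /Fb.
by have := Fb b (ltnSn b); case: (F b) => [|[]].
Qed.

Lemma mu_loopSS F b y : mu_loop F b = y.+2 <->
  [/\ y < b, F y = 1 & forall z, z < y -> 1 < F z].
Proof.
elim: b => [|b IH] /=; first by split=> // -[].
rewrite -/(mu_loop F b).
case: (posnP (mu_loop F b)) => [b0 | b_gt0].
  have /mu_loop0 Fb := b0.
  split=> [|[]].
    case Eb: (F b) => [|[|v]] //= [<-]; split => //.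
  rewrite ltnS leq_eqVlt => /predU1P[-> -> //|lt_yb Fy _].
  by have := Fb _ lt_yb; rewrite Fy.
rewrite IH; split=> -[lt_yb Fy Fz]; split=> //; first exact: ltnW.
move: lt_yb; rewrite ltnS leq_eqVlt => /predU1P[Eyb | //].
by move: b_gt0; rewrite lt0n => /eqP[]; apply/mu_loop0; rewrite -Eyb.
Qed.

(* [stage c s xs] is [y.+1] if [c] is found to have value [y] at [xs] when every
   unbounded search is cut off after [s] steps, and [0] otherwise. *)
Fixpoint stage n (c : recfn n) (s : nat) (xs : seq nat) : nat :=
  match c with
  | Zero _ => 1
  | Succ => (head 0 xs).+2
  | Proj _ i => (nth 0 xs i).+1
  | Comp m _ f g =>
      if all (fun i => 0 < stage (g i) s xs) (enum 'I_m)
      then stage f s [seq (stage (g i) s xs).-1 | i <- enum 'I_m] else 0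
  | Rec _ f g =>
      natrec (stage f s (behead xs))
        (fun k z => if z == 0 then 0 else stage g s (k :: z.-1 :: behead xs))
        (head 0 xs)
  | Mu _ f => (mu_loop (fun y => stage f s (y :: xs)) s).-1
  end.

(** A zero found in [s] rounds remains the first zero under a later cut-off, since all earlier
    values were already defined. A search that is stuck yields [0], so it may still succeed at a
    later stage. *)
Lemma stage_mono n (c : recfn n) s s' xs y :
  s <= s' -> stage c s xs = y.+1 -> stage c s' xs = y.+1.
Proof.
move=> le_ss'; elim: c xs y => {n} [n||n i|m n f IHf g IHg|n f IHf g IHg|n f IHf] xs y //.
- rewrite /=; case: ifP => // /allP gP fy.
  have E i : stage (g i) s' xs = stage (g i) s xs.
    have /prednK/esym Ei := gP i (mem_enum _ i).
    by rewrite (IHg _ _ _ Ei).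
  rewrite (eq_all (a2 := fun i => 0 < stage (g i) s xs)); last by move=> i; rewrite E.
  have -> : all (fun i => 0 < stage (g i) s xs) (enum 'I_m) by apply/allP.
  by rewrite (eq_map (g := fun i => (stage (g i) s xs).-1)) ?(IHf _ _ fy) // => i; rewrite E.
- rewrite /=; elim: (head 0 xs) y => [|k IHk] y /=; first exact: IHf.
  case Ez: natrec => [|z] //=; rewrite (IHk _ Ez) /=; exact: IHg.
rewrite /= => Ey; have {}Ey : mu_loop (fun y => stage f s (y :: xs)) s = y.+2.
  by case: mu_loop Ey => // m /= ->.
suff -> : mu_loop (fun y => stage f s' (y :: xs)) s' = y.+2 by [].
have [lt_ys fy fz] := (mu_loopSS _ _ _).1 Ey.
apply/mu_loopSS; split=> [||z /fz]; first exact: leq_trans le_ss'.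
  exact: IHf fy.
by case Ez: (stage f s _) => [|[|v]] // _; rewrite (IHf _ _ Ez).
Qed.

Lemma bounded_stage (P : nat -> nat -> Prop) b :
    (forall z s s', s <= s' -> P z s -> P z s') ->
  (forall z, z < b -> exists s, P z s) -> exists s, forall z, z < b -> P z s.
Proof.
move=> Pmono; elim: b => [|b IH] ex; first by exists 0.
have [|s sP] := IH; first by move=> z /ltnW /ex.
have [s' s'P] := ex b (ltnSn b).
exists (maxn s s') => z; rewrite ltnS leq_eqVlt => /predU1P[-> | /sP].
  by apply: Pmono s'P; exact: leq_maxr.
by apply: Pmono; exact: leq_maxl.
Qed.

(** A converging computation uses finitely many subcomputations; by monotonicity, the maximum of
    their stages serves all of them at once. *)
Lemma evalP n (c : recfn n) (xs : n.-tuple nat) y :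
  eval c xs y <-> exists s, stage c s xs = y.+1.
Proof.
elim: c xs y => {n} [n||n i|m n f IHf g IHg|n f IHf g IHg|n f IHf] xs y /=.
- by split=> [-> | [_ [<-]]] //; exists 0.
- by case/tupleP: xs => x xs; split=> [-> | [_ [<-]]] //; exists 0.
- by rewrite (tnth_nth 0); split=> [-> | [_ [<-]]] //; exists 0.
- split=> [[ys ysP /IHf [s sP]] | [s]].
    have [||s' s'P] := @bounded_stage
      (fun z s => forall i : 'I_m, val i = z -> stage (g i) s xs = (tnth ys i).+1) m.
    + by move=> z s1 s2 le12 + i iz => /(_ i iz); exact: stage_mono.
    + move=> z zm; have /IHg [s' s'P] := ysP (Ordinal zm).
      by exists s' => i iz; rewrite (_ : i = Ordinal zm) //; exact/val_inj.
    exists (maxn s s').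
    have gi (i : 'I_m) : stage (g i) (maxn s s') xs = (tnth ys i).+1.
      by apply: (stage_mono (leq_maxr s s')); exact: s'P.
    case: ifP => [_ | /negP[]]; last by apply/allP => i _; rewrite gi.
    rewrite (eq_map (g := tnth ys)); last by move=> i; rewrite gi.
    by rewrite map_tnth_enum; exact: stage_mono (leq_maxl s s') sP.
  case: ifP => // /allP gP fy.
  exists [tuple (stage (g i) s xs).-1 | i < m].
    move=> i; rewrite tnth_mktuple; apply/IHg; exists s.
    by rewrite prednK // gP // mem_enum.
  by apply/IHf; exists s.
- have -> : head 0 xs = thead xs by case/tupleP: xs.
  elim: (thead xs) y => [|k IHk] y /=; first exact: IHf.
  split=> [[z /IHk [s sP] /IHg [s' s'P]] | [s]].
    exists (maxn s s').
    have : natrec (stage f (maxn s s') (behead xs)) (fun k z => if z == 0 then 0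
       else stage g (maxn s s') (k :: z.-1 :: behead xs)) k = z.+1.
      (* The first [k] rounds are the stage of [Rec f g] with leading argument [k], so monotonicity
         applies to them. *)
      exact: (stage_mono (c := Rec f g) (xs := k :: behead xs) (leq_maxl s s') sP).
    by move=> -> /=; exact: stage_mono (leq_maxr s s') s'P.
  case Ez: natrec => [|z] //= gy.
  by exists z; [apply/IHk; exists s | apply/IHg; exists s].
split=> [[/IHf [s sP] fP] | [s]].
  have [||s' s'P] := @bounded_stage (fun z s => 1 < stage f s (z :: xs)) y.
  + by move=> z s1 s2 le12; case E: (stage f s1 _) => [|[|v]] // _;
       rewrite (stage_mono le12 E).
  + move=> z /fP [v /IHf [s' s'P]]; exists s'; by rewrite s'P.
  (* The same number bounds the search, which needs [y.+1] rounds to test [y] itself. *)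
  exists (maxn y.+1 (maxn s s')); set b := maxn _ _.
  suff -> : mu_loop (fun y => stage f b (y :: xs)) b = y.+2 by [].
  apply/mu_loopSS; split.
  - exact: leq_maxl.
  - by apply: stage_mono sP; rewrite /b maxnCA leq_maxl.
  - move=> z /s'P; case E: (stage f s' _) => [|[|v]] // _.
    by rewrite (stage_mono _ E) // /b maxnA leq_maxr.
move=> Ey; have {}Ey : mu_loop (fun y => stage f s (y :: xs)) s = y.+2.
  by case: mu_loop Ey => // m /= ->.
have [lt_ys fy fz] := (mu_loopSS _ _ _).1 Ey.
split; first by apply/IHf; exists s.
move=> z /fz; case E: (stage f s _) => [|[|v]] // _.
by exists v; apply/IHf; exists s.
Qed.

Definition stage_seq n (c : recfn n) (l : seq nat) : nat :=
  stage c (head 0 l) (behead l).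

Lemma cfun_stage n (c : recfn n) : cfun n.+1 (stage_seq c).
Proof.
elim: c => {n} [n||n i|m n f IHf g IHg|n f IHf g IHg|n f IHf].
- exact: cfun_const.
- apply: (@cfun_ext _ (fun l => (nth 0 l 1).+2)).
    by move=> [|s [|x l]].
  exact/cfun_S/cfun_S/cfun_nth.
- apply: (@cfun_ext _ (fun l => (nth 0 l i.+1).+1)); first by case.
  exact/cfun_S/cfun_nth.
- apply: cfun_if.
  + elim: (enum _) => [|i r IHr] /=; first exact: cfun_const.
    apply: cpred_and IHr; apply: cpred_leq; [exact: cfun_const | exact: IHg].
  + pose Gs := head 0 :: [seq (fun l => (stage_seq (g i) l).-1) | i <- enum 'I_m].
    apply: (@cfun_ext _ (fun l => stage_seq f [seq G l | G <- Gs])).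
      by move=> l _; rewrite /= -map_comp.
    apply: (cfun_comp _ IHf) => [|[|i] im] /=.
    * by rewrite size_map size_enum_ord.
    * apply: (@cfun_ext _ (nth 0 ^~ 0)); [by case | exact: cfun_nth].
    * rewrite (nth_map (Ordinal (im : i < m))) ?size_enum_ord //.
      exact/cfun_pred/IHg.
  + exact: cfun_const.
(* Here [l] is [k :: z :: s :: x :: xs]: counter, previous encoded value, stage, and the original
   arguments, whose first one [x] is only the recursion length. *)
- pose G (l : seq nat) := if nth 0 l 1 == 0 then 0 else
    stage_seq g (nth 0 l 2 :: nth 0 l 0 :: (nth 0 l 1).-1 :: drop 4 l).
  apply: (@cfun_ext _ (fun l => natrec (stage_seq f (nth 0 l 0 :: drop 2 l))
    (fun k z => G (k :: z :: l)) (nth 0 l 1))).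
    by move=> [|s [|x l]] //=; rewrite /G /= drop0.
  apply: cfun_natrec (cfun_nth _ _).
    apply: (cfun_cat (k := 2) (Gs := [:: nth 0 ^~ 0]) _ IHf) => // -[] // _.
    exact: cfun_nth.
  apply: cfun_if; [|exact: cfun_const|].
    by apply: cpred_eq; [exact: cfun_nth | exact: cfun_const].
  apply: (cfun_cat (k := 4) (Gs := [:: nth 0 ^~ 2; nth 0 ^~ 0; fun l => (nth 0 l 1).-1])
    _ IHg) => // -[|[|[|//]]] _.
  + exact: cfun_nth.
  + exact: cfun_nth.
  + exact/cfun_pred/cfun_nth.
(* Here [l] is [y :: z :: s :: xs]: candidate zero, state of the search, stage and arguments. *)
pose v (l : seq nat) := stage_seq f (nth 0 l 2 :: nth 0 l 0 :: drop 3 l).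
pose G (l : seq nat) := if 0 < nth 0 l 1 then nth 0 l 1 else
  if v l == 0 then 1 else if v l == 1 then (nth 0 l 0).+2 else 0.
apply: (@cfun_ext _ (fun l => (natrec 0 (fun k z => G (k :: z :: l)) (nth 0 l 0)).-1)).
  by move=> [|s l] //=; rewrite /G /v /= drop0.
have vP : cfun n.+3 v.
  apply: (cfun_cat (k := 3) (Gs := [:: nth 0 ^~ 2; nth 0 ^~ 0]) _ IHf) => //.
  by move=> [|[|//]] _; exact: cfun_nth.
apply/cfun_pred/cfun_natrec/cfun_nth; first exact: cfun_const.
apply: cfun_if; [|exact: cfun_nth|apply: cfun_if; [|exact: cfun_const|apply: cfun_if]].
- by apply: cpred_leq; [exact: cfun_const | exact: cfun_nth].
- by apply: cpred_eq; [exact: vP | exact: cfun_const].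
- by apply: cpred_eq; [exact: vP | exact: cfun_const].
- exact/cfun_S/cfun_S/cfun_nth.
- exact: cfun_const.
Qed.

(** Replaces a partial computable function by total computable approximations, where [0] means no
    value yet. *)
Lemma computable_stages (p : pfun1) : partial_computable1 p ->
  exists2 e, computable2 e & forall x y, p x = Some y <-> exists s, e x s = y.+1.
Proof.
move=> [c cP]; exists (fun x s => stage c s [:: x]); last first.
  by move=> x y; rewrite cP evalP.
apply: computable2P.
apply: (cfun_comp (Gs := [:: nth 0 ^~ 1; nth 0 ^~ 0]) _ (cfun_stage c)) => //.
by move=> [|[|//]] _; exact: cfun_nth.
Qed.

Ltac cfun_tac := repeat first
  [ exact: cfun_nth | exact: cfun_const
  | match goal with
    | H : computable1 ?f |- cfun _ (fun xs => ?f _) =>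
        apply: (cfun_computable1 H)
    | H : computable2 ?f |- cfun _ (fun xs => ?f _ _) =>
        apply: (cfun_computable2 H)
    | |- cfun _ (fun xs => if _ then _ else _) => apply: cfun_if
    | |- cfun _ (fun xs => nat_of_bool (_ && _)) => apply: cpred_and
    | |- cfun _ (fun xs => nat_of_bool (~~ _)) => apply: cpred_neg
    | |- cfun _ (fun xs => nat_of_bool (_ == _)) => apply: cpred_eq
    | |- cfun _ (fun xs => nat_of_bool (_ <= _)) => apply: cpred_leq
    | |- cfun _ (fun xs => (_).+1) => apply: cfun_S
    | |- cfun _ (fun xs => (_).-1) => apply: cfun_pred
    end ].

(** * Computable inverses of the pairing function *)

(** Both components of a pair are at most its code [z], so searches below [z.+1] find them. *)
Lemma computable_unpairing pr : computable_pairing pr ->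
  exists p1 p2, [/\ computable1 p1, computable1 p2,
    forall x y, p1 (pr x y) = x, forall x y, p2 (pr x y) = y &
    forall z, pr (p1 z) (p2 z) = z].
Proof.
case=> prC pr_bij le1 le2.
(* [s x z] is a second component if [z] has first component [x], and junk otherwise; [p1] rules out
   the junk by testing the resulting pair against [z]. *)
pose s x z := bsearch (fun y => pr x y == z) z.+1.
pose p1 z := bsearch (fun x => pr x (s x z) == z) z.+1.
pose p2 z := s (p1 z) z.
have sC : computable2 s.
  apply: computable2P.
  apply: (cfun_bsearch (P := fun l => pr (nth 0 l 1) (nth 0 l 0) == nth 0 l 2));
    by cfun_tac.
have p1C : computable1 p1.
  apply: computable1P.
  apply: (cfun_bsearch
    (P := fun l => pr (nth 0 l 0) (s (nth 0 l 0) (nth 0 l 1)) == nth 0 l 1));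
    by cfun_tac.
have p2C : computable1 p2 by apply: computable1P; rewrite /p2; cfun_tac.
have sP x y : pr x (s x (pr x y)) = pr x y.
  apply/eqP; apply: (bsearchP (P := fun y' => pr x y' == pr x y) (c := y)) => //.
  by rewrite ltnS.
have prK x y : pr (p1 (pr x y)) (p2 (pr x y)) = pr x y.
  apply/eqP; apply: (bsearchP (P := fun x' => pr x' (s x' _) == _) (c := x)).
    by rewrite ltnS.
  by rewrite sP.
have inj x y x' y' : pr x y = pr x' y' -> x = x' /\ y = y'.
  by move=> /(bij_inj pr_bij (x1 := (x, y)) (x2 := (x', y')))[].
exists p1, p2; split=> // [x y|x y|z].
- by have [] := inj _ _ _ _ (prK x y).
- by have [] := inj _ _ _ _ (prK x y).
have [g _ gK] := pr_bij; rewrite -(gK z); exact: prK.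
Qed.

(** * Completeness of quasi-Gödel numberings *)

Section QuasiGoedel.

Context (pr : nat -> nat -> nat) (A : set nat) (theta : nat -> pfun1).
Context (p1 p2 f : nat -> nat).
Hypotheses (prC : computable2 pr) (p1C : computable1 p1) (p2C : computable1 p2).
Hypotheses (p1K : forall x y, p1 (pr x y) = x) (p2K : forall x y, p2 (pr x y) = y).
Hypothesis prK : forall z, pr (p1 z) (p2 z) = z.
Hypotheses (thetaS : forall j, S1 A (theta j)) (fC : computable1 f).
Hypotheses (fP : range f = ext_graph2 pr theta) (thetaQ : QGN2 pr A theta).

Lemma complete_stages (p : pfun1) e : computable2 e ->
    (forall x y, p x = Some y <-> exists s, e x s = y.+1) ->
  exists2 g, computable1 g &
    forall i, theta (g i) = if p i is Some j then theta j else nowhere.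
Proof.
move=> eC eP.
(* [t] codes a stage [s] of [p i] and a position [u] in the enumeration [f]. If stage [s] shows that
   [p i] is [j] and [f u] is [<<j, x>, w>], then [<x, w>] is listed; otherwise the harmless
   [<u, 0>]. *)
pose k i t := if (e i (p1 t) != 0) && (p1 (p1 (f (p2 t))) == (e i (p1 t)).-1)
  then pr (p2 (p1 (f (p2 t)))) (p2 (f (p2 t))) else pr (p2 t) 0.
have kC : computable2 k by apply: computable2P; rewrite /k; cfun_tac.
have [v vC vP] := thetaQ kC; exists v => // i; symmetry; apply: vP.
  by case: (p i) => // ; right; left; apply/seteqP; split.
have f_onto z : ext_graph2 pr theta z -> exists t, f t = z.
  by rewrite -fP => -[t _ <-]; exists t.
have f_in t : ext_graph2 pr theta (f t) by rewrite -fP; exists t.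
apply/seteqP; split=> [_ [t _ <-] | z].
  rewrite /k; case: ifP => [/andP[e0 /eqP jE] | _]; last by left; exists (p2 t).
  have -> : p i = Some (e i (p1 t)).-1.
    by apply/eP; exists (p1 t); rewrite prednK // lt0n.
  case: (f_in (p2 t)) jE => [[y [y' ->]] | [x [x' [w [xx' ->]]]]].
    by rewrite !(p1K, p2K) => <-; left; exists y'.
  by rewrite !(p1K, p2K) => <-; right; exists x', w.
have hit s u j x w : e i s = j.+1 -> f u = pr (pr j x) w -> k i (pr s u) = pr x w.
  by rewrite /k !p1K !p2K => -> ->; rewrite !(p1K, p2K) eqxx.
case=> [[y _ <-] | [x [w [+ ->]]]].
  (* If [p i] is not known at stage [0], the default branch lists [<y, 0>]; if it is, the pair comes
     from [<<j, y>, 0>] in the enumeration by [f]. *)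
  case e0: (e i 0) => [|j].
    by exists (pr 0 y) => //; rewrite /k p1K p2K e0.
  have [|u uE] := f_onto (pr (pr j y) 0); first by left; exists j, y.
  by exists (pr 0 u) => //; exact: hit uE.
case pE: (p i) => [j|//] jx; have [s sE] := (eP i j).1 pE.
have [|u uE] := f_onto (pr (pr j x) w.+1); first by right; exists j, x, w.
by exists (pr s u) => //; exact: hit uE.
Qed.

(** * Parametrization, recursion theorem and padding *)

(** Each [H x] is total, hence in [S1 A], and its extended graph is listed by letting [p1 t] choose
    between [<y, 0>] and [<y, H x y + 1>]. *)
Lemma smn H : computable2 H ->
  exists2 v, computable1 v & forall x, theta (v x) = fun y => Some (H x y).
Proof.
move=> HC.
pose k x t := pr (p2 t) (if p1 t == 0 then 0 else (H x (p2 t)).+1).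
have kC : computable2 k by apply: computable2P; rewrite /k; cfun_tac.
have [v vC vP] := thetaQ kC; exists v => // x; symmetry; apply: vP.
  left; exists (H x) => //; apply: computable1P; cfun_tac.
apply/seteqP; split=> [_ [t _ <-] | z].
  rewrite /k; case: ifP => _; first by left; exists (p2 t).
  by right; exists (p2 t), (H x (p2 t)).
case=> [[y _ <-] | [y [w [[<-] ->]]]].
  by exists (pr 0 y) => //; rewrite /k p1K p2K.
by exists (pr 1 y) => //; rewrite /k p1K p2K.
Qed.

(* [E] below comes from the recursion theorem: [E <<j, b>, c>] is an index of
   [theta j] if it exceeds [b], and of the constant function [c] otherwise. As
   distinct constants have distinct indices, it exceeds [b] for some
   [c <= b.+1]. *)
Lemma padding : exists2 W, computable2 W &
  forall j b, b < W j b /\ theta (W j b) = theta j.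
Proof.
(* Reads [theta x x] off the enumeration: a listed [<<x, x>, w>] contributes [w], which is already a
   value plus one, or [0] for no value. *)
pose diag x s := if p1 (f s) == pr x x then p2 (f s) else 0.
have [||g gC gP] := @complete_stages (fun x => theta x x) diag.
- by apply: computable2P; rewrite /diag; cfun_tac.
- move=> x y; split=> [xy | [s]].
    have : ext_graph2 pr theta (pr (pr x x) y.+1) by right; exists x, x, y.
    by rewrite -fP => -[s _ fs]; exists s; rewrite /diag fs p1K p2K eqxx.
  rewrite /diag; case: ifP => // /eqP fs1 fs2.
  have : ext_graph2 pr theta (f s) by rewrite -fP; exists s.
  case=> [[z [z' fsE]] | [z [z' [w [zz' fsE]]]]].
    by move: fs2; rewrite fsE p2K.
  move: fs1 fs2; rewrite fsE p1K p2K => zx [<-].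
  by rewrite -zz' -(p1K z z') -{2}(p2K z z') zx p1K p2K.
have [|d dC dP] := @smn (fun c _ => c).
  by apply: computable2P; cfun_tac.
(* Self-reference: [theta (v x)] is [H x], so [g (v x)] is an index of the function with index
   [H x (v x)], and the latter compares the bound with [g (v x)] itself. *)
pose H x t := if p2 (p1 x) < g t then p1 (p1 x) else d (p2 x).
have [|v vC vP] := @smn H.
  by apply: computable2P; rewrite /H; cfun_tac.
pose E x := g (v x).
have EP j b c : theta (E (pr (pr j b) c)) =
    if b < E (pr (pr j b) c) then theta j else fun=> Some c.
  by rewrite [LHS]gP vP /H !(p1K, p2K) -/(E _); case: ifP => // _; rewrite dP.
pose c j b := bsearch (fun c => b < E (pr (pr j b) c)) b.+2.
have cC : computable2 c.
  apply: computable2P.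
  apply: (cfun_bsearch (P := fun l =>
    nth 0 l 2 < E (pr (pr (nth 0 l 1) (nth 0 l 2)) (nth 0 l 0)))).
    by rewrite /E; cfun_tac.
  by cfun_tac.
exists (fun j b => E (pr (pr j b) (c j b))).
  by apply: computable2P; rewrite /E; cfun_tac.
move=> j b; suff bE : b < E (pr (pr j b) (c j b)) by rewrite EP bE.
have [c0 c0b bE] : exists2 c0, c0 < b.+2 & b < E (pr (pr j b) c0).
  apply: contrapT => noc.
  (* Pigeonhole: otherwise [b.+2] distinct constants would have indices among only [b.+1]
     numbers. *)
  pose h (c0 : 'I_b.+2) : 'I_b.+1 := inord (E (pr (pr j b) c0)).
  have Eb (c0 : 'I_b.+2) : E (pr (pr j b) c0) <= b.
    by rewrite leqNgt; apply/negP => bE; apply: noc; exists c0.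
  have /leq_card : injective h.
    move=> c0 c1 /(congr1 val); rewrite /h /= !inordK ?ltnS ?Eb // => E01.
    have := EP j b c0; rewrite E01 EP !ltnNge !Eb /=.
    by move=> /(congr1 (@^~ 0)) [?]; exact/val_inj.
  by rewrite !card_ord ltnn.
exact: (bsearchP (P := fun c => b < E (pr (pr j b) c)) c0b bE).
Qed.

(** * Cylindricity *)

(* [q] is a strictly increasing padding function, so its range [R] is decidable.
   The isomorphism enumerates [theta j]'s indices in [R] along the row [j], with
   [j] itself put in front when [j] is outside [R]. *)
Lemma quasi_Goedel_cylindrical : cylindrical pr theta.
Proof.
have [W WC WP] := padding.
pose q n := natrec (W (p2 0) 0) (fun k z => W (p2 k.+1) z) n.
have qC : computable1 q.
  apply: computable1P.
  by apply: (cfun_natrec (G := fun l => W (p2 (nth 0 l 0).+1) (nth 0 l 1)));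
    cfun_tac.
have q_lt : {homo q : m n / m < n}.
  by apply: homo_ltn ltn_trans _ => n; case: (WP (p2 n.+1) (q n)).
have q_inj : injective q.
  by move=> m n qmn; case: (ltngtP m n) => // /q_lt; rewrite qmn ltnn.
have q_ge n : n <= q n.
  by elim: n => // n IH; exact: leq_ltn_trans IH (q_lt _ _ (ltnSn n)).
have q_theta n : theta (q n) = theta (p2 n).
  by case: n => [|n]; [case: (WP (p2 0) 0) | case: (WP (p2 n.+1) (q n))].
(* Since [n <= q n], a preimage of [e] lies below [e.+1]; testing the search result again discards
   its junk value. *)
pose inR e := q (bsearch (fun n => q n == e) e.+1) == e.
have inRP e : reflect (exists n, q n = e) (inR e).
  apply: (iffP eqP) => [<- | [n qn]]; first by eexists.
  apply/eqP; apply: (bsearchP (P := fun n => q n == e) (c := n)).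
    by rewrite ltnS -qn.
  exact/eqP.
(* On a row [j] outside the range of [q], [<0, j>] goes to [j] and [<i + 1, j>] to [q <i, j>]; on
   the other rows [h] is [q]. *)
pose h z := if inR (p2 z) then q z
  else if p1 z == 0 then p2 z else q (pr (p1 z).-1 (p2 z)).
have hC : computable1 h.
  have bC : computable1 (fun e => bsearch (fun n => q n == e) e.+1).
    apply: computable1P.
    by apply: (cfun_bsearch (P := fun l => q (nth 0 l 0) == nth 0 l 1)); cfun_tac.
  apply: computable1P; rewrite /h /inR; cfun_tac.
  exact: (cfun_computable1 bC (cfun_computable1 p2C (cfun_nth 1 0))).
have h_theta z : theta (h z) = theta (p2 z).
  by rewrite /h; case: ifP => // _; case: ifP => // _; rewrite q_theta p2K.
have h_inj : injective h.
  have qR n e : ~~ inR e -> q n <> e by move=> /inRP eR qn; apply: eR; exists n.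
  move=> z z'; rewrite -(prK z) -(prK z').
  move: (p1 z) (p2 z) (p1 z') (p2 z') => i j i' j'; rewrite /h !p1K !p2K.
  case: (boolP (inR j)) => jR; case: (boolP (inR j')) => j'R.
  - exact: q_inj.
  - case: eqP => _ => [/qR|/q_inj /(congr1 p2)]; first exact.
    by rewrite !p2K => jj'; rewrite -jj' jR in j'R.
  - case: eqP => _ => [/esym /qR|/q_inj /(congr1 p2)]; first exact.
    by rewrite !p2K => jj'; rewrite jj' j'R in jR.
  (* The mixed cases would put [j] or [j'] into the range of [q]. *)
  - case: i i' => [|i] [|i'] /= => [->|/esym /qR|/qR|/q_inj ii'] //.
    have := congr1 p1 ii'; have := congr1 p2 ii'.
    by rewrite !p1K !p2K => -> ->.
have h_onto e : exists z, h z = e.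
  case: (boolP (inR e)) => [/inRP [n <-] | eR]; last first.
    by exists (pr 0 e); rewrite /h p1K p2K (negPf eR).
  (* For a value [q n], the preimage is [n] or, on a shifted row, the next position after [n]. *)
  case: (boolP (inR (p2 n))) => nR; first by exists n; rewrite /h nR.
  by exists (pr (p1 n).+1 (p2 n)); rewrite /h p1K p2K (negPf nR) /= prK.
have [h' h'K] := choice h_onto.
exists (theta \o p2); first by move=> i j /=; rewrite p2K.
exists h; split=> //; last by apply/funext => z /=; rewrite h_theta.
by exists h' => // z; apply: h_inj; rewrite h'K.
Qed.

End QuasiGoedel.

Theorem theorem8p3 (pr : nat -> nat -> nat) (Hpr : computable_pairing pr)
    (A : set nat) (HAinf : infinite_set A) (HAce : ce A)
    (theta : nat -> pfun1) (Htheta : quasi_Goedel_numbering pr A theta) :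
  complete_numbering theta nowhere /\ cylindrical pr theta.
Proof.
have [p1 [p2 [p1C p2C p1K p2K prK]]] := computable_unpairing Hpr.
have [prC _ _ _] := Hpr; have [thetaN [f fC fP] thetaQ] := Htheta.
have thetaS j : S1 A (theta j) by rewrite -thetaN; exists j.
split; last exact: (quasi_Goedel_cylindrical prC p1C p2C p1K p2K prK thetaS fC fP thetaQ).
move=> p /computable_stages[e eC eP].
exact: (complete_stages prC p1C p2C p1K p2K thetaS fC fP thetaQ eC eP).
Qed.
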